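(* Let $X$ be a non-empty set. The elements of $\mathsf{FFR}(X)$ can be identified with the pairs $(\Gamma,s)\in M(X^*,X\cup\overline{X^*})$ where $\Gamma$ is a $\rho$-closed subgraph of $\mathrm{Cay}(X^*,X\cup\overline{X^*})$, with the operations given by $$(\Gamma,s)(\Delta,t)=((\Gamma\cup s\Delta)^{\wedge},st),\qquad (\Gamma,s)^+=(\Gamma,\lambda),\qquad (\Gamma,s)^{\mathfrak{m}}=(\Gamma_{\overline{s}}^{\wedge},s).$$ That is, the set of these pairs with these operations and with the constant $(\Gamma_{\overline{\lambda}},\lambda)$ is $X$-canonically $(\cdot,{}^+,{}^{\mathfrak{m}},\lambda)$-isomorphic to $\mathsf{FFR}(X)$, where the generator $x\in X$ corresponds to $(\Gamma_x^{\wedge},x)$.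
   Context: A restriction semigroup is an algebra $(R;\cdot,{}^+)$ of type $(2,1)$ such that $(R;\cdot)$ is a semigroup and the identities $x^+x=x$, $x^+y^+=y^+x^+$, $(x^+y)^+=x^+y^+$, $xy^+=(xy)^+x$ hold. Its set of projections is $P(R)=\{s^+ : s\in R\}$. The natural partial order is $s\le t$ iff $s=et$ for some $e\in P(R)$. The congruence $\sigma$ is the minimum congruence identifying all projections: $s\mathrel{\sigma}t$ iff $es=et$ for some $e\in P(R)$. An $F$-restriction semigroup is a restriction semigroup in which every $\sigma$-class has a maximum element with respect to $\le$; the maximum element of the $\sigma$-class of $s$ is denoted $s^{\mathfrak{m}}$. It has a maximum projection, denoted $\lambda$, which is its unique left identity. $F$-restriction semigroups are regarded as algebras in the signature $(\cdot,{}^+,{}^{\mathfrak{m}},\lambda)$ of type $(2,1,1,0)$; they form a variety, and $\mathsf{FFR}(X)$ denotes the free $X$-generated object of this variety. A morphism of $X$-generated algebras is $X$-canonical if it commutes with the assignment maps from $X$. $X^*$ is the free monoid on $X$ with identity $\lambda$, and $\overline{X^*}=\{\overline{u}:u\in X^*\}$ is a disjoint bijective copy of $X^*$. The Cayley graph $\mathrm{Cay}(X^*,X\cup\overline{X^*})$ has vertex set $X^*$ and labeled directed edges $(w,x,wx)$ and $(w,\overline{u},wu)$ for $w\in X^*$, $x\in X$, $u\in X^*$. A subgraph is accessible if it contains the vertex $\lambda$ and each of its vertices is reachable by a directed path in the subgraph from $\lambda$. $M(X^*,X\cup\overline{X^*})$ is the set of all pairs $(\Gamma,s)$ where $\Gamma$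 is a finite accessible subgraph of $\mathrm{Cay}(X^*,X\cup\overline{X^*})$ with at least one edge and $s$ is a vertex of $\Gamma$. For a subgraph $\Delta$ and $s\in X^*$, $s\Delta$ is the left translate of $\Delta$ by $s$. For $y\in X\cup\overline{X^*}$, $\Gamma_y$ is the subgraph consisting of the single edge with label $y$ starting at $\lambda$, together with its endpoints. For a finite accessible subgraph $\Gamma$ with at least one edge, consider the transformations: ($T_1$) if $\Gamma$ has an edge $(v,\overline{u},vu)$ but not the edge $(v,\overline{\lambda},v)$, add the edge $(v,\overline{\lambda},v)$; ($T_2$) if $\Gamma$ has an edge $(v,x,vx)$ with $x\in X$ but not the edge $(v,\overline{x},vx)$, add the edge $(v,\overline{x},vx)$; ($T_3$) if $\Gamma$ has edges $(w,\overline{u},wu)$ and $(wu,\overline{v},wuv)$ but not the edge $(w,\overline{uv},wuv)$, add the edge $(w,\overline{uv},wuv)$. $\Gamma^{\wedge}$ denotes the finite graph obtained from $\Gamma$ by applying these transformations until none of them is applicable (the process terminates and the result does not depend on the choices). $\Gamma$ is called $\rho$-closed if $\Gamma=\Gamma^{\wedge}$. *)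

(* Defs.v *)
From Stdlib Require Import Relation_Operators.
From mathcomp Require Import all_boot finmap.
From mathcomp Require Import boolp classical_sets functions cardinality.

Set Implicit Arguments.
Unset Strict Implicit.
Unset Printing Implicit Defensive.

Local Open Scope classical_set_scope.

(** * Restriction and F-restriction semigroups *)

Record restriction_semigroup (R : Type) (mul : R -> R -> R) (plus : R -> R) :
    Prop := RestrictionSemigroup {
  rs_mulA : forall x y z, mul x (mul y z) = mul (mul x y) z;
  rs_plus_id : forall x, mul (plus x) x = x;
  rs_plusC : forall x y, mul (plus x) (plus y) = mul (plus y) (plus x);
  rs_plusM : forall x y, plus (mul (plus x) y) = mul (plus x) (plus y);
  rs_ample : forall x y, mul x (plus y) = mul (plus (mul x y)) x
}.

Definition projections (R : Type) (plus : R -> R) : set R :=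
  [set e | exists s, e = plus s].

Definition natural_le (R : Type) (mul : R -> R -> R) (plus : R -> R)
    (s t : R) : Prop :=
  exists2 e, projections plus e & s = mul e t.

Record congruence (R : Type) (mul : R -> R -> R) (plus : R -> R)
    (C : R -> R -> Prop) : Prop := Congruence {
  cong_refl : forall s, C s s;
  cong_sym : forall s t, C s t -> C t s;
  cong_trans : forall s t u, C s t -> C t u -> C s u;
  cong_mul : forall s t s' t', C s t -> C s' t' -> C (mul s s') (mul t t');
  cong_plus : forall s t, C s t -> C (plus s) (plus t)
}.

(* The minimum congruence identifying all projections, as the intersection of
   all of them; [sigmaE] is its usual elementwise description. *)
Definition sigma (R : Type) (mul : R -> R -> R) (plus : R -> R)
    (s t : R) : Prop :=
  forall C : R -> R -> Prop, congruence mul plus C ->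
    (forall e f, projections plus e -> projections plus f -> C e f) -> C s t.

Lemma sigmaE (R : Type) (mul : R -> R -> R) (plus : R -> R) :
  restriction_semigroup mul plus -> forall s t,
  sigma mul plus s t <-> exists2 e, projections plus e & mul e s = mul e t.
Proof.
move=> [mA pI pC pM am] s t; split=> [sst|]; last first.
  move=> [e [a ->] est] C HC Cp.
  have H z : C z (mul (plus a) z).
    have -> : mul (plus a) z = mul (mul (plus a) (plus z)) z by rewrite -mA pI.
    rewrite -{1}[z]pI; apply: (cong_mul HC); last exact: (cong_refl HC).
    by apply: Cp; [exists z | exists (mul (plus a) z); rewrite pM].
  apply: (cong_trans HC) (H s) _; rewrite est; apply: (cong_sym HC); exact: H.
pose D x y := exists2 e, projections plus e & mul e x = mul e y.
have pp a b : mul (plus a) (plus b) = plus (mul (plus a) b) by rewrite pM.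
have idem c : mul (plus c) (plus c) = plus c by rewrite pp pI.
have Dtrans x y z : D x y -> D y z -> D x z.
  move=> [_ [a ->] xy] [_ [b ->] yz]; exists (mul (plus a) (plus b)).
    by exists (mul (plus a) b).
  by rewrite -[RHS]mA -yz mA pC -mA xy -[RHS]mA mA.
apply: (sst D).
  split=> [x|x y|//|x y x' y' [_ [a ->] xy] [_ [b ->] xy']|x y [_ [a ->] xy]].
  - by exists (plus x) => //; exists x.
  - by move=> [e pe xy]; exists e.
  - apply: (Dtrans _ (mul y x')).
      by exists (plus a); [exists a | rewrite !mA xy].
    exists (plus (mul y b)); first by exists (mul y b).
    by rewrite !mA -am -!mA xy'.
  - by exists (plus a); [exists a | rewrite -!pM xy].
move=> _ _ [a ->] [b ->]; exists (mul (plus a) (plus b)).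
  by exists (mul (plus a) b).
by rewrite -[RHS]mA idem pC -mA idem.
Qed.

(* Algebras in the signature (mul, plus, m, lambda) of type (2,1,1,0). *)
Record falgebra : Type := FAlgebra {
  fcarrier :> Type;
  fmul : fcarrier -> fcarrier -> fcarrier;
  fplus : fcarrier -> fcarrier;
  fmax : fcarrier -> fcarrier;
  flam : fcarrier
}.

Record F_restriction (R : falgebra) : Prop := FRestriction {
  F_restr : restriction_semigroup (@fmul R) (@fplus R);
  F_max_sigma : forall s : R, sigma (@fmul R) (@fplus R) s (fmax s);
  F_max_ge : forall s t : R, sigma (@fmul R) (@fplus R) s t ->
    natural_le (@fmul R) (@fplus R) t (fmax s);
  F_lam_proj : projections (@fplus R) (flam R);
  F_lam_ge : forall e : R, projections (@fplus R) e ->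
    natural_le (@fmul R) (@fplus R) e (flam R)
}.

Record fmorphism (R S : falgebra) (f : R -> S) : Prop := FMorphism {
  fmorph_mul : forall x y, f (fmul x y) = fmul (f x) (f y);
  fmorph_plus : forall x, f (fplus x) = fplus (f x);
  fmorph_max : forall x, f (fmax x) = fmax (f x);
  fmorph_lam : f (flam R) = flam S
}.

Definition canonical_for (X : Type) (R S : falgebra) (i : X -> R) (j : X -> S)
    (f : R -> S) : Prop := forall x, f (i x) = j x.

(* [(F, i)] is the free X-generated object FFR(X) of the variety. *)
Definition is_FFR (X : Type) (F : falgebra) (i : X -> F) : Prop :=
  F_restriction F /\
  forall (R : falgebra) (j : X -> R), F_restriction R ->
    exists! f : F -> R, fmorphism f /\ canonical_for i j f.

(** * Subgraphs of Cay(X^*, X + overline X^* ) *)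

Definition word (X : Type) := seq X.

(* [inl x] is the letter x and [inr u] is the barred word. *)
Definition label (X : Type) := (X + word X)%type.

Definition label_val (X : Type) (y : label X) : word X :=
  match y with inl x => [:: x] | inr u => u end.

(* The edge (w, y, w y) is encoded by its source and its label. *)
Definition edge (X : Type) := (word X * label X)%type.

Definition src (X : Type) (e : edge X) : word X := e.1.
Definition tgt (X : Type) (e : edge X) : word X := e.1 ++ label_val e.2.

Record graph (X : Type) := Graph {
  vtx : set (word X);
  edg : set (edge X)
}.

Definition is_subgraph (X : Type) (G : graph X) : Prop :=
  forall e, edg G e -> vtx G (src e) /\ vtx G (tgt e).

Definition arrow (X : Type) (G : graph X) (v w : word X) : Prop :=
  exists e, [/\ edg G e, src e = v & tgt e = w].

Definition accessible (X : Type) (G : graph X) : Prop :=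
  vtx G [::] /\ forall v, vtx G v -> clos_refl_trans _ (arrow G) [::] v.

Definition finite_graph (X : Type) (G : graph X) : Prop :=
  finite_set (vtx G) /\ finite_set (edg G).

Record admissible (X : Type) (G : graph X) : Prop := Admissible {
  adm_subgraph : is_subgraph G;
  adm_finite : finite_graph G;
  adm_accessible : accessible G;
  adm_edge : edg G !=set0
}.

(* The set M(X^*, X + overline X^* ). *)
Definition in_M (X : Type) (p : graph X * word X) : Prop :=
  admissible p.1 /\ vtx p.1 p.2.

Definition graph_union (X : Type) (G H : graph X) : graph X :=
  Graph (vtx G `|` vtx H) (edg G `|` edg H).

Definition translate (X : Type) (s : word X) (G : graph X) : graph X :=
  Graph [set s ++ v | v in vtx G] [set (s ++ e.1, e.2) | e in edg G].

Definition edge_graph (X : Type) (y : label X) : graph X :=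
  Graph [set [::]; label_val y] [set ([::], y)].

(** * The transformations T1, T2, T3 and the closure *)

Definition add_edge (X : Type) (G : graph X) (e : edge X) : graph X :=
  Graph (vtx G) (e |` edg G).

(* [addable G e]: one of T1, T2, T3 is applicable to G and adds the edge e. *)
Inductive addable (X : Type) (G : graph X) : edge X -> Prop :=
| T1 v u : edg G (v, inr u) -> ~ edg G (v, inr [::]) ->
    addable G (v, inr [::])
| T2 v x : edg G (v, inl x) -> ~ edg G (v, inr [:: x]) ->
    addable G (v, inr [:: x])
| T3 w u v : edg G (w, inr u) -> edg G (w ++ u, inr v) ->
    ~ edg G (w, inr (u ++ v)) -> addable G (w, inr (u ++ v)).

Definition step (X : Type) (G H : graph X) : Prop :=
  exists2 e, addable G e & H = add_edge G e.

Definition normal_form (X : Type) (G H : graph X) : Prop :=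
  clos_refl_trans _ (@step X) G H /\ forall K, ~ step H K.

(* Finite subgraphs have exactly one normal form ([normal_form_exists] and
   [normal_form_unique]); the value on other graphs is irrelevant. *)
Definition closure (X : Type) (G : graph X) : graph X :=
  if pselect (exists H, normal_form G H) is left ex then projT1 (cid ex) else G.

Definition rho_closed (X : Type) (G : graph X) : Prop := G = closure G.

Lemma graph_eq (X : Type) (G H : graph X) :
  vtx G = vtx H -> edg G `<=` edg H -> edg H `<=` edg G -> G = H.
Proof.
by case: G H => [V E] [V' E'] /= -> EE' E'E; congr Graph; apply/seteqP.
Qed.

Lemma step_vtx (X : Type) (G H : graph X) :
  clos_refl_trans _ (@step X) G H -> vtx H = vtx G.
Proof.
by elim=> {G H} [G H [e _ ->]|G|G H K _ e1 _ e2] //; rewrite e2 e1.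
Qed.

Lemma step_edg (X : Type) (G H : graph X) :
  clos_refl_trans _ (@step X) G H -> edg G `<=` edg H.
Proof.
elim=> {G H} [G H [e _ ->]|G|G H K _ e1 _ e2] //; first by move=> f; right.
exact: subset_trans e1 e2.
Qed.

Lemma no_stepE (X : Type) (G : graph X) :
  (forall K, ~ step G K) <-> (forall e, ~ addable G e).
Proof.
split=> [nG e ae|nG K [e ae _]]; last exact: nG ae.
by apply: (nG (add_edge G e)); exists e.
Qed.

Lemma step_min (X : Type) (G H K : graph X) :
  clos_refl_trans _ (@step X) G H -> (forall e, ~ addable K e) ->
  edg G `<=` edg K -> edg H `<=` edg K.
Proof.
move=> GH nK; elim: GH => {G H} [G H [e ae ->] GK|G|G H L _ h1 _ h2 GK] //.
  move=> f [->{f}|]; last exact: GK.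
  apply: contrapT => ne; case: ae ne => [v u h _|v x h _|w u v h h' _] ne.
  - exact: nK (T1 (GK _ h) ne).
  - exact: nK (T2 (GK _ h) ne).
  - exact: nK (T3 (GK _ h) (GK _ h') ne).
exact: h2 (h1 GK).
Qed.

Lemma normal_form_unique (X : Type) (G H K : graph X) :
  normal_form G H -> normal_form G K -> H = K.
Proof.
move=> [GH /no_stepE nH] [GK /no_stepE nK].
apply: graph_eq; first by rewrite (step_vtx GH) (step_vtx GK).
  exact: step_min GH nK (step_edg GK).
exact: step_min GK nH (step_edg GH).
Qed.

Lemma addable_new (X : Type) (G : graph X) e : addable G e -> ~ edg G e.
Proof. by case. Qed.

Lemma addable_ends (X : Type) (G : graph X) e : is_subgraph G ->
  addable G e -> [/\ vtx G (src e), vtx G (tgt e) & exists u, e.2 = inr u].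
Proof.
move=> sG [v u /sG[h _] _|v x /sG h _|w u v /sG[h _] /sG[_ h'] _];
  rewrite /src /tgt /=.
- by rewrite cats0; split=> //; exists [::].
- by case: h; split=> //; exists [:: x].
- by move: h'; rewrite /tgt /= catA; split=> //; exists (u ++ v).
Qed.

Lemma step_subgraph (X : Type) (G H : graph X) : is_subgraph G ->
  clos_refl_trans _ (@step X) G H -> is_subgraph H.
Proof.
move=> + GH; elim: GH => {G H} [G H [e ae ->] sG f|G|G H K _ h1 _ h2 /h1/h2] //.
by move=> [->|/sG//]; case: (addable_ends sG ae).
Qed.

Lemma normal_form_exists (X : Type) (G : graph X) :
  is_subgraph G -> finite_graph G -> exists H, normal_form G H.
Proof.
move=> sG [fV fE].
pose join (v w : word X) : edge X := (v, inr (drop (size v) w)).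
pose E : set (edge X) := edg G `|` [set join v w | v in vtx G & w in vtx G].
have fin_E : finite_set E by rewrite finite_setU; split=> //; exact: finite_image2.
suff H n : forall K, clos_refl_trans _ (@step X) G K -> edg K `<=` E ->
    (#|` fset_set ((E `\` edg K) : set {classic edge X})| < n)%N ->
    exists H, normal_form G H.
  apply: (H _ G); [exact: rt_refl | by move=> e; left | exact: ltnSn].
elim: n => // n IHn K GK KE ltn.
have [[K' [e ae K'E]]|nK] := pselect (exists K', step K K'); last first.
  by exists K; split=> // K' KK'; apply: nK; exists K'.
have Ee : E e.
  have [] := addable_ends (step_subgraph sG GK) ae; rewrite (step_vtx GK).
  case: e {ae K'E} => v y /= sv tv [u yu]; right; exists v => //.
  by exists (v ++ u); [move: tv; rewrite /tgt /= yu | rewrite /join drop_size_cat ?yu].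
apply: (IHn K').
- by apply: (rt_trans _ _ _ K) => //; apply: rt_step; exists e.
- by rewrite K'E => f [->|/KE].
- apply: leq_trans (ltn : (_ <= n)%N); apply: fproper_ltn_card.
  have fin_D (A : set (edge X)) : finite_set ((E `\` A) : set {classic edge X}).
    exact: finite_setD.
  rewrite fproperE; apply/andP; split.
    apply/fsubsetP => f; rewrite !in_fset_set// !inE K'E => -[Ef nf].
    by split=> // Kf; apply: nf; right.
  apply/negP => /fsubsetP/(_ (e : {classic edge X})).
  rewrite !in_fset_set// !inE K'E => sub.
  have [] := sub (conj Ee (addable_new ae)).
  by move=> _; apply; left.
Qed.

Lemma closureP (X : Type) (G : graph X) :
  is_subgraph G -> finite_graph G -> normal_form G (closure G).
Proof.
move=> sG fG; rewrite /closure; case: pselect => [ex|[]]; first by case: cid.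
exact: normal_form_exists.
Qed.

Lemma rho_closedP (X : Type) (G : graph X) : is_subgraph G -> finite_graph G ->
  rho_closed G <-> forall e, ~ addable G e.
Proof.
move=> sG fG; have nG := closureP sG fG; split=> [eG|/no_stepE nA].
  by case: nG; rewrite -eG => _ /no_stepE.
by apply: normal_form_unique nG; split=> //; exact: rt_refl.
Qed.

Lemma closure_admissible (X : Type) (G : graph X) :
  admissible G -> admissible (closure G).
Proof.
move=> [sG fG aG eG]; have [GC _] := closureP sG fG.
have sC := step_subgraph sG GC; have [fV fE] := fG.
split=> //.
- split; first by rewrite (step_vtx GC).
  suff: edg (closure G) `<=`
      edg G `|` [set (v, inr (drop (size v) w)) | v in vtx G & w in vtx G].
    move/sub_finite_set; apply; rewrite finite_setU; split=> //.
    exact: finite_image2.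
  elim: GC sG {fG aG eG sC fV fE}
      => {G} [G H [e ae ->] sG f|G sG f|G H K GH h1 _ h2 sG f].
  + move=> [->{f}|]; last by left.
    have [] := addable_ends sG ae; case: e {ae} => v y /= sv tv [u yu]; right.
    exists v => //; exists (v ++ u); first by move: tv; rewrite /tgt /= yu.
    by rewrite drop_size_cat ?yu.
  + by left.
  + move=> /(h2 (step_subgraph sG GH)) [/(h1 sG)//|].
    by rewrite (step_vtx GH); right.
- case: aG => G0 aG; split; first by rewrite (step_vtx GC).
  move=> v; rewrite (step_vtx GC) => /aG; elim=> {v} [v w [e [Ge <- <-]]|v|u v w _ h _ h'].
  + by apply: rt_step; exists e; split=> //; exact: step_edg Ge.
  + exact: rt_refl.
  + exact: rt_trans h h'.
- by case: eG => e Ge; exists e; exact: step_edg Ge.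
Qed.

Lemma closure_rho_closed (X : Type) (G : graph X) :
  admissible G -> rho_closed (closure G).
Proof.
move=> aG; have [sC fC _ _] := closure_admissible aG.
apply/(rho_closedP sC fC)/no_stepE.
by case: (closureP (adm_subgraph aG) (adm_finite aG)).
Qed.

Lemma closure_vtx (X : Type) (G : graph X) :
  admissible G -> vtx (closure G) = vtx G.
Proof.
by move=> [sG fG _ _]; have [GC _] := closureP sG fG; exact: step_vtx.
Qed.

Lemma product_admissible (X : Type) (G D : graph X) (s : word X) :
  admissible G -> vtx G s -> admissible D ->
  admissible (graph_union G (translate s D)).
Proof.
move=> [sG [fVG fEG] [G0 aG] eG] Gs [sD [fVD fED] [D0 aD] eD].
have GU v w : clos_refl_trans _ (arrow G) v w ->
    clos_refl_trans _ (arrow (graph_union G (translate s D))) v w.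
  elim=> {v w} [v w [e [Ge <- <-]]|v|u v w _ h _ h'].
  - by apply: rt_step; exists e; split=> //; left.
  - exact: rt_refl.
  - exact: rt_trans h h'.
have DU v w : clos_refl_trans _ (arrow D) v w ->
    clos_refl_trans _ (arrow (graph_union G (translate s D))) (s ++ v) (s ++ w).
  elim=> {v w} [v w [e [De <- <-]]|v|u v w _ h _ h'].
  - apply: rt_step; exists (s ++ e.1, e.2); split=> //; first by right; exists e.
    by rewrite /tgt /= catA.
  - exact: rt_refl.
  - exact: rt_trans h h'.
split=> /=.
- move=> e [/sG[? ?]|[f /sD[h h'] <-]]; first by split; left.
  split; right; first by exists (src f).
  by exists (tgt f) => //; rewrite /tgt /= catA.
- by split; rewrite finite_setU; split=> //; exact: finite_image.
- split; first by left.
  move=> v [/aG/GU//|[w /aD/DU + <-]].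
  by apply: rt_trans; rewrite cats0; exact: GU (aG _ Gs).
- by case: eG => e Ge; exists e; left.
Qed.

Lemma edge_graph_admissible (X : Type) (y : label X) :
  admissible (edge_graph y).
Proof.
split=> /=.
- by move=> _ ->; split; [left | right].
- by split; [exact: finite_set2 | exact: finite_set1].
- split; first by left.
  move=> v [->|->]; first exact: rt_refl.
  by apply: rt_step; exists ([::], y).
- by exists ([::], y).
Qed.

(** * The algebra of pairs *)

(* The [_subproof] lemmas show that the operations are well defined: they send
   pairs of M with rho-closed graph to such pairs. *)

Definition in_FFR_model (X : Type) (p : graph X * word X) : Prop :=
  in_M p /\ rho_closed p.1.

Definition model (X : Type) : Type := {p : graph X * word X | in_FFR_model p}.

Lemma closure_in_model (X : Type) (G : graph X) (s : word X) :
  admissible G -> vtx G s -> in_FFR_model (closure G, s).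
Proof.
move=> aG Gs; split; last exact: closure_rho_closed.
by split; [exact: closure_admissible | rewrite /= closure_vtx].
Qed.

Lemma model_mul_subproof (X : Type) (p q : model X) :
  in_FFR_model (closure (graph_union (sval p).1
                           (translate (sval p).2 (sval q).1)),
                (sval p).2 ++ (sval q).2).
Proof.
case: p q => [[G s] [[/= aG Gs] _]] [[D t] [[/= aD Dt] _]] /=.
by apply: closure_in_model; [exact: product_admissible | right; exists t].
Qed.

Definition model_mul (X : Type) (p q : model X) : model X :=
  exist _ _ (model_mul_subproof p q).

Lemma model_plus_subproof (X : Type) (p : model X) :
  in_FFR_model ((sval p).1, [::]).
Proof.
by case: p => [[G s] [[/= aG Gs] rG]]; split=> //; split=> //;
  case: aG => _ _ [G0 _] _.
Qed.

Definition model_plus (X : Type) (p : model X) : model X :=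
  exist _ _ (model_plus_subproof p).

Lemma edge_graph_in_model (X : Type) (y : label X) :
  in_FFR_model (closure (edge_graph y), label_val y).
Proof.
by apply: closure_in_model; [exact: edge_graph_admissible | right].
Qed.

Definition model_max (X : Type) (p : model X) : model X :=
  exist _ _ (edge_graph_in_model (inr (sval p).2)).

Lemma model_lam_subproof (X : Type) :
  @in_FFR_model X (edge_graph (inr [::]), [::]).
Proof.
have [sG fG aG eG] := edge_graph_admissible (inr [::] : label X).
split; first by split=> //; left.
apply/(rho_closedP sG fG) => e ae; have := addable_new ae.
by case: ae => [v u [-> _] _|v x []//|w u v [-> ->] [->] _] /=; apply.
Qed.

Definition model_lam (X : Type) : model X := exist _ _ (@model_lam_subproof X).

Definition model_gen (X : Type) (x : X) : model X :=
  exist _ _ (edge_graph_in_model (inl x)).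

Definition FFR_model (X : Type) : falgebra :=
  FAlgebra (@model_mul X) (@model_plus X) (@model_max X) (@model_lam X).

(* Main.v *)
Require Import Defs.
From mathcomp Require Import all_boot.
From Stdlib Require Import Relation_Operators Operators_Properties.
From Stdlib Require List.
From mathcomp Require Import boolp classical_sets cardinality.

(** The algebra of pairs is shown to satisfy the defining universal property of
    the free object; the isomorphism with any other realisation is then the
    usual comparison of two objects with the same universal property.

    The transformations T1, T2, T3 make the edge set of the closure of G the set
    [derived] from the edges of G by three monotone rules ([edg_closure]).
    Derivability is monotone and compatible with translations, so the axioms reduce
    to inclusions between edge sets. This suffices for equality of elements,
    because in a closed accessible graph with an edge the vertices v are exactly
    the targets of the edges (lambda, bar v, v) ([medg_vtx], [model_ext]): barred
    edges along a path from lambda compose by T3. As two pairs are sigma-related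
    iff their words agree, the maximum above (G, s) carries the least closed
    graph with vertex s, that of the edge bar s.

    Existence of a morphism to an F-restriction semigroup R, given j : X -> R.
    A word u has a canonical value [hat u], the maximum of the sigma-class of the
    product of its letters. It only satisfies hat u * hat v <= hat (u v), and the
    projection (hat u * hat v)^+ measures how far equality fails. Accordingly an
    edge (w, y, wy) is sent to the projection (hat w * y')^+, where y' is j y for a
    letter y and hat u for y = bar u, and (G, s) is sent to the meet of the
    projections of the edges of G, times hat s ([eval]). The rules T1, T2,
    T3 add only edges whose projection lies above the meet of those of the edges
    which trigger them ([edge_proj_derived]), so that closing a graph leaves its meet
    unchanged. In a product, moving the meet of the second graph to the left
    across hat s replaces hat w by hat s * hat w; this agrees with hat (s w)
    below (hat s * hat w)^+, which is the projection of the translate of the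
    edge (lambda, bar w, w) of that graph ([eval_mul]).

    Uniqueness holds because the letters generate the algebra
    ([model_generated]): products of letters give elements with any word, their
    maxima are the barred edges, an edge at w comes from the product of the
    barred edge of w with it, and a graph is the product of its edges. *)

Import Defs.

Set Implicit Arguments.
Unset Strict Implicit.
Unset Printing Implicit Defensive.

Local Open Scope classical_set_scope.

(** * Closure as derivability of edges *)

Lemma finite_set_In (T : Type) (A : set T) :
  finite_set A -> exists l : seq T, forall x, A x <-> List.In x l.
Proof.
move=> /(@finite_seqP {classic T})[l ->]; exists l => x /=.
elim: l => [|y l IH] /=; first by rewrite in_nil; split.
rewrite in_cons; split=> [/orP[/eqP->|/IH]|[->|/IH xl]]; [by left|by right| |].
  by rewrite eqxx.
by rewrite xl orbT.
Qed.

Section Derived.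
Variable X : Type.
Implicit Types (E F : set (edge X)) (G : graph X).

(** Unlike [closure], which is a normal form of a rewriting that forbids adding
    an edge twice, this is monotone by construction and admits induction. *)
Inductive derived E : set (edge X) :=
| derived_base e : E e -> derived E e
| derived_T1 v u : derived E (v, inr u) -> derived E (v, inr [::])
| derived_T2 v x : derived E (v, inl x) -> derived E (v, inr [:: x])
| derived_T3 w u v : derived E (w, inr u) -> derived E (w ++ u, inr v) ->
    derived E (w, inr (u ++ v)).

Lemma derived_sub E F : E `<=` derived F -> derived E `<=` derived F.
Proof.
move=> EF e; elim=> {e} [e /EF//|v u _ h|v x _ h|w u v _ h _ h'].
- exact: derived_T1 h.
- exact: derived_T2.
- exact: derived_T3.
Qed.

(** The derivable edges form a graph to which no rule applies, so the normal
    form stays inside them; conversely a normal form is closed under the rules. *)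
Lemma edg_closure G : is_subgraph G -> finite_graph G ->
  edg (closure G) = derived (edg G).
Proof.
move=> sG fG; have [GC /no_stepE nC] := closureP sG fG.
apply/seteqP; split.
  apply: (step_min (K := Graph (vtx G) (derived (edg G))) GC) => /=.
    move=> e ae; case: ae (addable_new ae) => [v u h _|v x h _|w u v h h' _] /= [].
    - exact: derived_T1 h.
    - exact: derived_T2.
    - exact: derived_T3.
  by move=> e; exact: derived_base.
move=> e; elim=> {e} [e Ge|v u _ h|v x _ h|w u v _ h _ h'].
- exact: step_edg GC _ Ge.
- by apply: contrapT => n; exact: nC (T1 h n).
- by apply: contrapT => n; exact: nC (T2 h n).
- by apply: contrapT => n; exact: nC (T3 h h' n).
Qed.

Definition shift (s : word X) E : set (edge X) :=
  [set (s ++ e.1, e.2) | e in E].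

Lemma shift_derived s E : shift s (derived E) `<=` derived (shift s E).
Proof.
move=> _ [e + <-]; elim=> {e} [e Ee|v u _ h|v x _ h|w u v _ h _ h'] /=.
- by apply: derived_base; exists e.
- exact: derived_T1 h.
- exact: derived_T2.
- by apply: derived_T3 => //; rewrite -catA.
Qed.

End Derived.

(** * The algebra of pairs is an F-restriction semigroup *)

Section Model.
Variable X : Type.
Implicit Types p q r : model X.

Definition mvtx p : set (word X) := vtx (sval p).1.
Definition medg p : set (edge X) := edg (sval p).1.
Definition mword p : word X := (sval p).2.

Lemma model_admissible p : admissible (sval p).1.
Proof. by case: p => [[G s] [[]]]. Qed.

Lemma derived_medg p : derived (medg p) = medg p.
Proof.
have [sG fG _ _] := model_admissible p.
rewrite /medg -edg_closure//; move: sG fG => _ _.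
by case: p => [[G s] [_ /= {2}->]].
Qed.

Lemma derived_subm E p : E `<=` medg p -> derived E `<=` medg p.
Proof.
by move=> Ep; rewrite -derived_medg; apply: derived_sub; rewrite derived_medg.
Qed.

Lemma medg_T1 p v u : medg p (v, inr u) -> medg p (v, inr [::]).
Proof. by rewrite -derived_medg => h; exact: derived_T1 h. Qed.

Lemma medg_bar p v y : medg p (v, y) -> medg p (v, inr (label_val y)).
Proof.
by case: y => [x|//]; rewrite -derived_medg => h; exact: derived_T2 h.
Qed.

Lemma medg_T3 p w u v : medg p (w, inr u) -> medg p (w ++ u, inr v) ->
  medg p (w, inr (u ++ v)).
Proof. by rewrite -derived_medg => h h'; exact: derived_T3. Qed.

(** The graph has an edge, and its source is reachable from lambda, so some edge
    starts at lambda; T2 and T1 turn it into the barred empty loop. *)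
Lemma medg_nil p : medg p ([::], inr [::]).
Proof.
have [sG _ [_ aG] [[v y] Ge]] := model_admissible p.
suff [z hz] : exists z, medg p ([::], z) by apply: medg_T1 (medg_bar hz).
have : clos_refl_trans _ (arrow (sval p).1) [::] v.
  by apply: aG; case: (sG _ Ge).
move=> h; have := clos_rt_rt1n _ _ _ _ h => {h} vP.
case: vP Ge => [|a b [[c z] [Gf cE _]] _ _].
  by exists y.
by exists z; rewrite -cE.
Qed.

(** Barred edges along a path from lambda compose by T3. Hence the vertices of a
    closed graph can be read off its edges. *)
Lemma medg_vtx p v : mvtx p v <-> medg p ([::], inr v).
Proof.
have [sG _ [_ aG] _] := model_admissible p; split; last first.
  by move=> /sG[_].
move=> /aG h; have := clos_rt_rtn1 _ _ _ _ h => {h}.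
elim=> {v} [|v w [[a y] [Ge aE <-]] _ h].
  exact: medg_nil.
by rewrite -aE in h; apply: medg_T3 => //; exact: medg_bar.
Qed.

Lemma medg_word p : medg p ([::], inr (mword p)).
Proof. by apply/medg_vtx; case: p => [[G s] [[]]]. Qed.

Lemma model_ext p q : medg p `<=` medg q -> medg q `<=` medg p ->
  mword p = mword q -> p = q.
Proof.
move=> pq qp pqw; apply: eq_sig_hprop => [a u v|]; first exact: Prop_irrelevance.
have : (sval p).1 = (sval q).1.
  apply: graph_eq => //; apply/seteqP; split=> v /medg_vtx h; apply/medg_vtx.
    exact: pq.
  exact: qp.
by move: pqw; rewrite /mword; case: (sval p) (sval q) => a b [c d] /= -> ->.
Qed.

Lemma medg_mul p q :
  medg (model_mul p q) = derived (medg p `|` shift (mword p) (medg q)).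
Proof.
have pw : vtx (sval p).1 (mword p) by apply/medg_vtx; exact: medg_word.
have [sG fG _ _] :=
  product_admissible (model_admissible p) pw (model_admissible q).
by rewrite /medg /= edg_closure.
Qed.

Lemma mword_mul p q : mword (model_mul p q) = mword p ++ mword q.
Proof. by []. Qed.

Lemma medg_edge_closure y s (h : in_FFR_model (closure (edge_graph y), s)) :
  medg (exist _ _ h) = derived [set ([::], y)].
Proof. by rewrite /medg /= edg_closure//; case: (edge_graph_admissible y). Qed.

Lemma medg_max p : medg (model_max p) = derived [set ([::], inr (mword p))].
Proof. exact: medg_edge_closure. Qed.

Lemma medg_gen x : medg (model_gen x) = derived [set ([::], inl x)].
Proof. exact: medg_edge_closure. Qed.

Lemma shift_nil (E : set (edge X)) : shift [::] E = E.
Proof.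
by apply/seteqP; split=> [_ [[v y] h <-]|[v y] h] //; exists (v, y).
Qed.

Lemma shift_cat s t (E : set (edge X)) : shift s (shift t E) = shift (s ++ t) E.
Proof.
apply/seteqP; split=> [_ [_ [e h <-] <-]|_ [e h <-]] /=.
  by exists e; rewrite // catA.
by exists (t ++ e.1, e.2); [exists e | rewrite /= catA].
Qed.

Lemma medg_mull p q : medg p `<=` medg (model_mul p q).
Proof. by move=> e h; rewrite medg_mul; apply: derived_base; left. Qed.

Lemma medg_mulr p q : shift (mword p) (medg q) `<=` medg (model_mul p q).
Proof. by move=> e h; rewrite medg_mul; apply: derived_base; right. Qed.

(** With [medg_mull] and [medg_mulr], this says that the graph of a product is
    the least closed graph containing the two factors' edges in place; every
    identity below is checked through it by double inclusion. *)
Lemma medg_mul_sub p q r : medg p `<=` medg r ->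
  shift (mword p) (medg q) `<=` medg r -> medg (model_mul p q) `<=` medg r.
Proof.
by move=> pr qr; rewrite medg_mul; apply: derived_subm => e [/pr|/qr].
Qed.

Lemma model_mulA p q r :
  model_mul p (model_mul q r) = model_mul (model_mul p q) r.
Proof.
apply: model_ext; last by rewrite !mword_mul catA.
  apply: medg_mul_sub.
    exact: subset_trans (@medg_mull _ _) (@medg_mull _ _).
  rewrite [medg (model_mul q r)]medg_mul.
  apply: subset_trans (@shift_derived _ _ _) _; apply: derived_subm.
  move=> _ [e [qe|re] <-]; first by apply: medg_mull; apply: medg_mulr; exists e.
  by apply: medg_mulr; rewrite mword_mul -shift_cat; exists e.
apply: medg_mul_sub.
  apply: medg_mul_sub; first exact: medg_mull.
  by move=> _ [e qe <-]; apply: medg_mulr; exists e => //; exact: medg_mull.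
rewrite mword_mul -shift_cat => _ [e re <-].
by apply: medg_mulr; exists e => //; exact: medg_mulr.
Qed.

Lemma model_plus_mul_sub p q r : medg p `<=` medg r -> medg q `<=` medg r ->
  medg (model_mul (model_plus p) q) `<=` medg r.
Proof. by move=> pr qr; apply: medg_mul_sub => //; rewrite shift_nil. Qed.

Lemma model_plus_mulr p q : medg q `<=` medg (model_mul (model_plus p) q).
Proof.
by rewrite -{1}[medg q]shift_nil; exact: (@medg_mulr (model_plus p) q).
Qed.

Lemma model_restriction : restriction_semigroup (@model_mul X) (@model_plus X).
Proof.
split=> [|p|p q|p q|p q]; first exact: model_mulA.
- by apply: model_ext => //; [exact: model_plus_mul_sub|exact: model_plus_mulr].
- apply: model_ext => //; apply: model_plus_mul_sub;
    by [exact: model_plus_mulr|exact: medg_mull].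
- by apply: model_ext.
- apply: model_ext; last by rewrite !mword_mul cats0.
    exact: (@medg_mull (model_plus (model_mul p q)) p).
  by apply: model_plus_mul_sub => //; exact: (@medg_mull p q).
Qed.

(** If the words agree, multiplying by the projection of the closed union of both
    graphs equalises the two elements. *)
Lemma model_sigma p q :
  sigma (@model_mul X) (@model_plus X) p q <-> mword p = mword q.
Proof.
split.
  move=> /(sigmaE model_restriction)[_ [a ->] e].
  by have := congr1 mword e; rewrite !mword_mul.
move=> pq; apply/(sigmaE model_restriction).
pose r := model_mul (model_plus p) q; exists (model_plus r); first by exists r.
have pr : medg p `<=` medg r by exact: (@medg_mull (model_plus p) q).
have qr : medg q `<=` medg r by exact: model_plus_mulr.
have rm t : medg r `<=` medg (model_mul (model_plus r) t).
  exact: (@medg_mull (model_plus r) t).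
apply: model_ext; last by rewrite !mword_mul pq.
  by apply: model_plus_mul_sub; [exact: rm | exact: subset_trans (@rm _)].
by apply: model_plus_mul_sub; [exact: rm | exact: subset_trans (@rm _)].
Qed.

Lemma model_F_restriction : F_restriction (FFR_model X).
Proof.
split.
- exact: model_restriction.
- by move=> p; apply/model_sigma.
- move=> p q /model_sigma pq; exists (model_plus q); first by exists q.
  apply: model_ext; [exact: (@medg_mull (model_plus q) _)| |by []].
  apply: model_plus_mul_sub => //; rewrite medg_max pq.
  by apply: derived_subm => _ ->; exact: medg_word.
- by exists (model_lam X); apply: model_ext.
- move=> _ [p ->]; exists (model_plus p); first by exists p.
  apply: model_ext; [exact: (@medg_mull (model_plus p) _)| |by []].
  by apply: model_plus_mul_sub => // _ ->; exact: medg_nil.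
Qed.

End Model.

(** * Generation by the letters *)

Section Generation.
Variables (X : Type) (D : set (model X)).
Hypotheses (D_gen : forall x, D (model_gen x)) (D_lam : D (model_lam X))
  (D_mul : forall p q, D p -> D q -> D (model_mul p q))
  (D_plus : forall p, D p -> D (model_plus p))
  (D_max : forall p, D p -> D (model_max p)).

Lemma generate_word u : exists2 p, D p & mword p = u.
Proof.
elim: u => [|x u [p Dp pu]]; first by exists (model_lam X).
by exists (model_mul (model_gen x) p); [exact: D_mul | rewrite mword_mul pu].
Qed.

Lemma generate_label (y : label X) :
  exists p, [/\ D p, mword p = label_val y & medg p = derived [set ([::], y)]].
Proof.
case: y => [x|u]; first by exists (model_gen x); split=> //; exact: medg_gen.
have [p Dp <-] := generate_word u.
by exists (model_max p); split; [exact: D_max | | exact: medg_max].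
Qed.

(** For an edge (w, y, wy) of the graph of p, the product of the barred edge of w
    with the edge y works: it contains this edge, and the only other edge it
    brings before closure, (lambda, bar w, w), is in the graph because w is one
    of its vertices. *)
Lemma generate_edge p f : medg p f ->
  exists q, [/\ D q, medg q `<=` medg p & medg q f].
Proof.
case: f => w y pf.
have [a [Da aw aE]] := generate_label (inr w).
have [b [Db _ bE]] := generate_label y.
have sb : shift w (medg b) `<=` derived [set (w, y)].
  rewrite bE; apply: subset_trans (@shift_derived _ _ _) _.
  by apply: derived_sub => _ [_ -> <-]; apply: derived_base; rewrite /= cats0.
exists (model_mul a b); split; first exact: D_mul.
  apply: medg_mul_sub.
    rewrite aE; apply: derived_subm => _ ->; apply/medg_vtx.
    by case: (adm_subgraph (model_admissible p) pf).
  by rewrite aw; apply: subset_trans sb _; apply: derived_subm => _ ->.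
apply: medg_mulr; exists ([::], y); last by rewrite aw /= cats0.
by rewrite bE; exact: derived_base.
Qed.

Lemma generate_edges p l : (forall f, List.In f l -> medg p f) ->
  exists q, [/\ D q, medg q `<=` medg p & forall f, List.In f l -> medg q f].
Proof.
elim: l => [|f l IH] pl.
  by exists (model_lam X); split=> // _ ->; exact: medg_nil.
have [a [Da ap af]] := generate_edge (pl f (or_introl erefl)).
have [b [Db bp bl]] := IH (fun g lg => pl g (or_intror lg)).
exists (model_mul (model_plus a) b); split.
- by apply: D_mul => //; exact: D_plus.
- exact: model_plus_mul_sub.
- move=> g [<-|/bl]; last exact: model_plus_mulr.
  by apply: (@medg_mull _ (model_plus a)).
Qed.

Lemma model_generated p : D p.
Proof.
have [l lE] := finite_set_In (adm_finite (model_admissible p)).2.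
have [|q [Dq qp pq]] := @generate_edges p l; first by move=> f /lE.
have [b [Db bw bE]] := generate_label (inr (mword p)).
suff -> : p = model_mul (model_plus q) b by apply: D_mul => //; exact: D_plus.
apply: model_ext => //.
  by move=> f /lE/pq; apply: (@medg_mull _ (model_plus q)).
apply: model_plus_mul_sub => //; rewrite bE.
by apply: derived_subm => _ ->; exact: medg_word.
Qed.

End Generation.

(** * Projections and the natural order *)

Section Restriction.
Variables (R : Type) (mul : R -> R -> R) (plus : R -> R).
Hypothesis HR : restriction_semigroup mul plus.
Local Notation "x ** y" := (mul x y) (at level 40, left associativity).

Let mulA := rs_mulA HR.

Lemma plus_idem x : plus x ** plus x = plus x.
Proof. by rewrite -(rs_plusM HR) (rs_plus_id HR). Qed.

Lemma plus_plus x : plus (plus x) = plus x.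
Proof.
rewrite -{1}(plus_idem x) (rs_plusM HR) (rs_plusC HR).
exact: (rs_plus_id HR).
Qed.

Lemma plus_mul_le x y : plus (x ** y) ** plus x = plus (x ** y).
Proof. by rewrite (rs_plusC HR) -(rs_plusM HR) mulA (rs_plus_id HR). Qed.

Lemma plus_mul_plus x y : plus (x ** plus y) = plus (x ** y).
Proof. by rewrite (rs_ample HR) (rs_plusM HR) plus_mul_le. Qed.

Lemma proj_le_trans (q a b : R) : q ** a = q -> a ** b = a -> q ** b = q.
Proof. by move=> qa ab; rewrite -qa -mulA ab. Qed.

Lemma proj_le_antisym a b :
  plus a ** plus b = plus a -> plus b ** plus a = plus b -> plus a = plus b.
Proof. by move=> ab ba; rewrite -ab (rs_plusC HR). Qed.

(** The natural order, with the canonical choice of the projection. *)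
Definition below (a b : R) := a = plus a ** b.

Lemma natural_le_below a b : natural_le mul plus a b -> below a b.
Proof.
move=> [_ [c ->] ->]; rewrite /below (rs_plusM HR) -mulA.
by rewrite (rs_plus_id HR).
Qed.

Lemma below_mul2l c a b : below a b -> below (c ** a) (c ** b).
Proof.
by move=> ab; rewrite /below mulA -(rs_ample HR) -mulA -ab.
Qed.

Lemma below_mul2r c a b : below a b -> below (a ** c) (b ** c).
Proof.
move=> ab; apply: natural_le_below.
by exists (plus a); [exists a | rewrite mulA -ab].
Qed.

Lemma below_plus a b : below a b -> plus a ** plus b = plus a.
Proof. by move=> ab; rewrite -(rs_plusM HR) -ab. Qed.

Lemma below_antisym a b : below a b -> below b a -> a = b.
Proof.
move=> ab ba; rewrite ab (proj_le_antisym (below_plus ab) (below_plus ba)).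
exact: (rs_plus_id HR).
Qed.

(** Below a^+, the elements a <= b are indistinguishable as left factors. *)
Lemma plus_mul_below q a b c : below a b ->
  q ** plus a = q -> q ** plus (b ** c) = q -> q ** plus (a ** c) = q.
Proof.
by move=> ab qa qbc; rewrite {1}ab -mulA (rs_plusM HR) mulA qa.
Qed.

Lemma sigma_refl s : sigma mul plus s s.
Proof. by move=> C HC _; exact: (cong_refl HC). Qed.

Lemma sigma_sym s t : sigma mul plus s t -> sigma mul plus t s.
Proof. by move=> st C HC Cp; apply: (cong_sym HC); exact: st. Qed.

Lemma sigma_trans t s u :
  sigma mul plus s t -> sigma mul plus t u -> sigma mul plus s u.
Proof.
by move=> st tu C HC Cp; apply: (cong_trans HC (st C HC Cp)); exact: tu.
Qed.

Lemma sigma_mul s t s' t' : sigma mul plus s t -> sigma mul plus s' t' ->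
  sigma mul plus (s ** s') (t ** t').
Proof.
by move=> st st' C HC Cp; apply: (cong_mul HC); [exact: st | exact: st'].
Qed.

Lemma sigma_proj_mul e x : sigma mul plus (plus e ** x) x.
Proof.
apply/(sigmaE HR); exists (plus e); first by exists e.
by rewrite mulA plus_idem.
Qed.

Lemma sigma_mul_proj e x : sigma mul plus (x ** plus e) x.
Proof. by rewrite (rs_ample HR); exact: sigma_proj_mul. Qed.

End Restriction.

(** * Evaluation in an F-restriction semigroup *)

Section FRestriction.
Variables (R : falgebra).
Hypothesis HF : F_restriction R.
Local Notation "x ** y" := (fmul x y) (at level 40, left associativity).
Local Notation plus := (@fplus R).
Local Notation lam := (flam R).
Local Notation below := (below (@fmul R) plus).
Local Notation sigma := (sigma (@fmul R) plus).
Let HR := F_restr HF.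
Let mulA := rs_mulA HR.

Lemma plus_lam : plus lam = lam.
Proof. by have [a ->] := F_lam_proj HF; exact: plus_plus HR _. Qed.

Lemma proj_lam e : plus e ** lam = plus e.
Proof.
have [|_ [a ->] ->] := F_lam_ge HF (e := plus e); first by exists e.
by rewrite -mulA -{2}plus_lam -{1}plus_lam (plus_idem HR) plus_lam.
Qed.

Lemma lam_mul x : lam ** x = x.
Proof.
rewrite -{1}(rs_plus_id HR x) -plus_lam mulA (rs_plusC HR) plus_lam proj_lam.
exact: (rs_plus_id HR).
Qed.

Lemma sigma_below_max s t : sigma s t -> below s (fmax t).
Proof.
move=> st; apply: (natural_le_below HR); apply: (F_max_ge HF).
exact: sigma_sym.
Qed.

Lemma fmax_sigma s t : sigma s t -> fmax s = fmax t.
Proof.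
move=> st; apply: (below_antisym HR); apply: sigma_below_max.
  by apply: sigma_trans st; apply: sigma_sym; exact: (F_max_sigma HF).
apply: (sigma_trans _ (sigma_sym st)); apply: sigma_sym.
exact: (F_max_sigma HF).
Qed.

(** All projections are sigma-related, so t, the maximum of their class, lies
    above the projection t^+; as these have the same image under ^+, they are
    equal. So t is a projection, and lambda is the greatest one. *)
Lemma fmax_lam : fmax lam = lam.
Proof.
have slp e : sigma lam (plus e).
  by rewrite -proj_lam; apply: sigma_sym; exact: (sigma_proj_mul HR).
rewrite (fmax_sigma (slp (fmax lam))).
set t := fmax lam.
have tmax : fmax (plus t) = t by rewrite -(fmax_sigma (slp t)).
have tt : below (plus t) t.
  by rewrite -{2}tmax; apply: sigma_below_max; exact: sigma_refl.
have et : t = plus t.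
  by move: tt; rewrite /below (plus_plus HR) (rs_plus_id HR).
rewrite tmax; apply: (below_antisym HR).
  by rewrite /below et (plus_plus HR) proj_lam.
by apply: sigma_below_max; exact: sigma_refl.
Qed.

Variables (X : Type) (j : X -> R).

Definition word_val (u : word X) : R := foldr (fun x a => j x ** a) lam u.

Lemma word_val_cat u v : word_val (u ++ v) = word_val u ** word_val v.
Proof. by elim: u => [|x u IH] /=; rewrite ?lam_mul// IH mulA. Qed.

(** The value of a word should depend on its sigma-class only and be as large as
    possible, since the barred letter must be sent to a maximum element. *)
Definition hat (u : word X) : R := fmax (word_val u).

Definition label_hat (y : label X) : R :=
  match y with inl x => j x | inr u => hat u end.

Lemma hat_nil : hat [::] = lam.
Proof. exact: fmax_lam. Qed.

Lemma sigma_hat u : sigma (hat u) (word_val u).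
Proof. by apply: sigma_sym; exact: (F_max_sigma HF). Qed.

Lemma sigma_label_hat y : sigma (label_hat y) (word_val (label_val y)).
Proof.
case: y => [x|u] /=; last exact: sigma_hat.
by apply: sigma_sym; rewrite -plus_lam; exact: (sigma_mul_proj HR).
Qed.

Lemma label_hat_below y : below (label_hat y) (hat (label_val y)).
Proof. by apply: sigma_below_max; exact: sigma_label_hat. Qed.

Lemma hat_label_hat_below w y :
  below (hat w ** label_hat y) (hat (w ++ label_val y)).
Proof.
apply: sigma_below_max; rewrite word_val_cat.
by apply: sigma_mul; [exact: sigma_hat | exact: sigma_label_hat].
Qed.

(** The domain of the element reached by walking to the source of the edge and
    then along it. Using [hat] of the source makes it independent of the path. *)
Definition edge_proj (e : edge X) : R := plus (hat e.1 ** label_hat e.2).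

Lemma edge_proj_derived1 v u :
  edge_proj (v, inr u) ** edge_proj (v, inr [::]) = edge_proj (v, inr u).
Proof.
rewrite /edge_proj /= hat_nil.
have -> : hat v ** hat u = hat v ** lam ** hat u by rewrite -mulA lam_mul.
exact: (plus_mul_le HR).
Qed.

Lemma edge_proj_derived2 v x :
  edge_proj (v, inl x) ** edge_proj (v, inr [:: x]) = edge_proj (v, inl x).
Proof.
apply: (below_plus HR); apply: (below_mul2l HR).
exact: (label_hat_below (inl x)).
Qed.

(** Below (hat w * hat u)^+ the element hat (w u) can be replaced by
    hat w * hat u, and then hat u * hat v lies below hat (u v). *)
Lemma edge_proj_derived3 q w u v : q ** edge_proj (w, inr u) = q ->
  q ** edge_proj (w ++ u, inr v) = q -> q ** edge_proj (w, inr (u ++ v)) = q.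
Proof.
move=> qu qv; have := plus_mul_below HR (hat_label_hat_below w (inr u)) qu qv.
move/(proj_le_trans HR); apply; apply: (below_plus HR); rewrite -mulA.
by apply: (below_mul2l HR); exact: (hat_label_hat_below u (inr v)).
Qed.

(** A greatest lower bound of the edge projections which left multiplication by
    any s preserves. The stronger condition is what a product needs, where the
    meet of the second graph appears to the right of the value of a word. The
    hypothesis on s * lambda accounts for the empty set, whose meet is lambda:
    lambda need not be a right identity. *)
Record is_meet (E : set (edge X)) (e : R) : Prop := IsMeet {
  meet_proj : plus e = e;
  meet_lb : forall f, E f -> e ** edge_proj f = e;
  meet_mul_glb : forall s q, q ** plus (s ** lam) = q ->
    (forall f, E f -> q ** plus (s ** edge_proj f) = q) -> q ** plus (s ** e) = q
}.

Lemma meet_glb E e q : is_meet E e ->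
  q ** lam = q -> (forall f, E f -> q ** edge_proj f = q) -> q ** e = q.
Proof.
move=> me ql qE; have := meet_mul_glb me (s := lam) (q := q).
rewrite !lam_mul (meet_proj me); apply; first by rewrite plus_lam.
by move=> f Ef; rewrite lam_mul (plus_plus HR) qE.
Qed.

Lemma meet_lam E e : is_meet E e -> e ** lam = e.
Proof. by move=> me; rewrite -(meet_proj me) proj_lam. Qed.

Lemma meet_exists (l : seq (edge X)) :
  exists e, is_meet [set f | List.In f l] e.
Proof.
elim: l => [|f l [e me]]; first by exists lam; split=> //; exact: plus_lam.
have pe : edge_proj f ** e = plus (edge_proj f ** e).
  by rewrite /edge_proj (rs_plusM HR) (meet_proj me).
exists (edge_proj f ** e); split=> [//|g [<-|lg]|s q qs qE].
- by rewrite -(meet_proj me) /edge_proj -mulA (rs_plusC HR) mulA (plus_idem HR).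
- by rewrite -mulA (meet_lb me lg).
- have qf := qE f (or_introl erefl).
  have -> : s ** (edge_proj f ** e) = plus (s ** edge_proj f) ** (s ** e).
    rewrite /edge_proj (plus_mul_plus HR) mulA [s ** plus _](rs_ample HR).
    by rewrite -mulA.
  rewrite (rs_plusM HR) mulA qf.
  by apply: (meet_mul_glb me) => // g lg; apply: qE; right.
Qed.

Implicit Types p q : model X.

(** Lower bounds of the edge projections of a graph are lower bounds for its
    closure. *)
Lemma edge_proj_derived c E e : derived E e ->
  (forall f, E f -> c ** edge_proj f = c) -> c ** edge_proj e = c.
Proof.
move=> Ee cE; elim: Ee => {e} [e /cE//|v u _ h|v x _ h|w u v _ h _ h'].
- exact: (proj_le_trans HR h (edge_proj_derived1 v u)).
- exact: (proj_le_trans HR h (edge_proj_derived2 v x)).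
- exact: (edge_proj_derived3 h h').
Qed.

Lemma meet_unique E e e' : is_meet E e -> is_meet E e' -> e = e'.
Proof.
move=> me me'; rewrite -(meet_proj me) -(meet_proj me').
apply: (proj_le_antisym HR); rewrite (meet_proj me) (meet_proj me').
  by apply: (meet_glb me'); [exact: (meet_lam me) | exact: (meet_lb me)].
by apply: (meet_glb me); [exact: (meet_lam me') | exact: (meet_lb me')].
Qed.

(** Evaluates the graphs of the letters, of the maxima and of lambda: closing a
    single edge does not change its meet. *)
Lemma meet_derived1 E f e : E f -> E `<=` derived [set f] ->
  is_meet E e -> e = edge_proj f.
Proof.
move=> Ef fE me; rewrite -(meet_proj me); apply: (proj_le_antisym HR).
  by rewrite (meet_proj me); exact: (meet_lb me Ef).
rewrite (meet_proj me); apply: (meet_glb me); first exact: proj_lam.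
move=> g /fE/edge_proj_derived; apply=> _ ->; exact: plus_idem.
Qed.

Lemma graph_meet_exists p : exists e, is_meet (medg p) e.
Proof.
have [l lE] := finite_set_In (adm_finite (model_admissible p)).2.
have [e me] := meet_exists l; exists e.
by rewrite (_ : medg p = [set f | List.In f l])//; apply/predeqP.
Qed.

Definition graph_meet p : R := projT1 (cid (graph_meet_exists p)).

Lemma graph_meetP p : is_meet (medg p) (graph_meet p).
Proof. by rewrite /graph_meet; case: cid. Qed.

Definition eval p : R := graph_meet p ** hat (mword p).

Lemma edge_proj_nil u : edge_proj ([::], inr u) = plus (hat u).
Proof. by rewrite /edge_proj /= hat_nil lam_mul. Qed.

Lemma graph_meet_word p : graph_meet p ** plus (hat (mword p)) = graph_meet p.
Proof.
by rewrite -edge_proj_nil; apply: (meet_lb (graph_meetP p)); exact: medg_word.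
Qed.

(** Moving the meet of the second graph to the left of hat s turns it into
    (hat s * meet)^+. The point is that, times the meet of the first graph, it is
    the meet of the product graph. The edges (lambda, bar w, w) of the second
    graph supply the bounds (hat s * hat w)^+, below which hat s * hat w and
    hat (s w) can be exchanged. *)
Lemma eval_mul p q : eval (model_mul p q) = eval p ** eval q.
Proof.
pose Q := graph_meet (model_mul p q).
have mQ : is_meet (medg (model_mul p q)) Q by exact: graph_meetP.
have mp := graph_meetP p; have mq := graph_meetP q.
set s := mword p; set t := mword q.
have Qshift w y : medg q (w, y) -> Q ** edge_proj (s ++ w, y) = Q.
  by move=> qwy; apply: (meet_lb mQ); apply: medg_mulr; exists (w, y).
have Qbar w : mvtx q w -> Q ** plus (hat s ** hat w) = Q.
  by move=> /medg_vtx /Qshift; rewrite cats0.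
have QE : Q = graph_meet p ** plus (hat s ** graph_meet q).
  rewrite -(meet_proj mQ) -(meet_proj mp) -(rs_plusM HR).
  apply: (proj_le_antisym HR);
    rewrite (rs_plusM HR) (meet_proj mQ) (meet_proj mp).
    (* The meet of the product is below both factors. *)
    rewrite mulA (meet_glb mp); first last.
    - by move=> f pf; apply: (meet_lb mQ); exact: medg_mull.
    - exact: (meet_lam mQ).
    apply: (meet_mul_glb mq) => [|[w y] qwy].
      by rewrite -hat_nil; apply: Qbar; apply/medg_vtx; exact: medg_nil.
    rewrite (plus_mul_plus HR) /= mulA.
    apply: (plus_mul_below HR (hat_label_hat_below s (inr w))).
      by apply: Qbar; case: (adm_subgraph (model_admissible q) qwy).
    exact: Qshift.
  (* The product of the factors is below every edge projection. *)
  apply: (meet_glb mQ); first by rewrite -mulA proj_lam.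
  move=> f; rewrite medg_mul => /edge_proj_derived.
  apply=> {f} f [pf|[[w y] qwy <-]].
    by rewrite -mulA (rs_plusC HR) mulA (meet_lb mp pf).
  rewrite -mulA; congr (_ ** _).
  apply: (proj_le_trans HR (a := plus (hat s ** edge_proj (w, y)))).
    have -> : graph_meet q = edge_proj (w, y) ** graph_meet q.
      by rewrite -{1}(meet_lb mq qwy) -(meet_proj mq) (rs_plusC HR).
    rewrite mulA; exact: (plus_mul_le HR).
  rewrite (plus_mul_plus HR) /= mulA; apply: (below_plus HR).
  by apply: (below_mul2r HR); exact: (hat_label_hat_below s (inr w)).
have -> : eval (model_mul p q) = Q ** hat (s ++ t) by [].
have -> : eval p ** eval q = Q ** (hat s ** hat t).
  have sE : hat s ** graph_meet q = plus (hat s ** graph_meet q) ** hat s.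
    by rewrite -{1}(meet_proj mq) (rs_ample HR).
  by rewrite /eval -/s -/t mulA -[_ ** graph_meet q]mulA sE QE !mulA.
(* Q absorbs the projection by which hat s * hat t falls short of hat (s t),
   since t is a vertex of the second graph. *)
rewrite (hat_label_hat_below s (inr t)) /= mulA.
by rewrite Qbar//; apply/medg_vtx; exact: medg_word.
Qed.

Lemma eval_morphism : @fmorphism (FFR_model X) R eval.
Proof.
split=> [p q|p|p|]; first exact: eval_mul.
- rewrite /= /eval hat_nil.
  rewrite (meet_unique (graph_meetP (model_plus p)) (graph_meetP p)).
  rewrite (meet_lam (graph_meetP p)).
  rewrite -[X in plus (X ** _)](meet_proj (graph_meetP p)).
  by rewrite (rs_plusM HR) (meet_proj (graph_meetP p)) graph_meet_word.
- rewrite /= /eval -[in RHS](meet_proj (graph_meetP p)).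
  rewrite (fmax_sigma (sigma_proj_mul HR _ _)).
  rewrite (fmax_sigma (sigma_hat _)) -/(hat _).
  rewrite (meet_derived1 _ _ (graph_meetP (model_max p))
    (f := ([::], inr (mword p)))).
  + by rewrite edge_proj_nil (rs_plus_id HR).
  + by rewrite medg_max; exact: derived_base.
  + by rewrite medg_max.
- rewrite /= /eval.
  rewrite (meet_derived1 _ _ (graph_meetP (model_lam X))
    (f := ([::], inr [::]))).
  + by rewrite edge_proj_nil hat_nil plus_lam lam_mul.
  + by [].
  + by move=> f; exact: derived_base.
Qed.

Lemma eval_gen x : eval (model_gen x) = j x.
Proof.
rewrite /eval (meet_derived1 _ _ (graph_meetP (model_gen x))
  (f := ([::], inl x))).
- rewrite /edge_proj /= hat_nil lam_mul.
  by rewrite -(label_hat_below (inl x)).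
- by rewrite medg_gen; exact: derived_base.
- by rewrite medg_gen.
Qed.

End FRestriction.

(** * Freeness *)

Lemma fmorphism_unique (X : Type) (R : falgebra) (f g : FFR_model X -> R) :
  @fmorphism (FFR_model X) R f -> @fmorphism (FFR_model X) R g ->
  (forall x, f (model_gen x) = g (model_gen x)) -> f = g.
Proof.
move=> [fM fP fm fl] [gM gP gm gl] fg; apply: funext.
apply: (@model_generated X [set p | f p = g p]) => //=.
- by rewrite fl gl.
- by move=> p q pE qE; rewrite fM gM pE qE.
- by move=> p pE; rewrite fP gP pE.
- by move=> p pE; rewrite fm gm pE.
Qed.

Lemma model_FFR (X : Type) : @is_FFR X (FFR_model X) (@model_gen X).
Proof.
split; first exact: model_F_restriction.
move=> R j HR; exists (eval HR j); split.
  by split; [exact: eval_morphism | move=> x; exact: eval_gen].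
move=> g [gM gj]; apply: fmorphism_unique => //; first exact: eval_morphism.
by move=> x; rewrite eval_gen gj.
Qed.

Lemma fmorphism_comp (R S T : falgebra) (f : R -> S) (g : S -> T) :
  fmorphism f -> fmorphism g -> fmorphism (g \o f).
Proof.
move=> [fM fP fm fl] [gM gP gm gl]; split=> [x y|x|x|] /=.
- by rewrite fM gM.
- by rewrite fP gP.
- by rewrite fm gm.
- by rewrite fl gl.
Qed.

(** The composites of the two canonical morphisms are canonical endomorphisms,
    hence identities by uniqueness. *)
Lemma FFR_iso (X : Type) (F G : falgebra) (i : X -> F) (k : X -> G) :
  is_FFR i -> is_FFR k ->
  exists f : F -> G, fmorphism f /\ bijective f /\ canonical_for i k f.
Proof.
move=> [FF uF] [FG uG].
have [f [[fM fi] _]] := uF G k FG; have [g [[gM gk] _]] := uG F i FF.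
have endo (H : falgebra) (h : X -> H) (u : H -> H) : is_FFR h ->
    fmorphism u -> canonical_for h h u -> u =1 id.
  move=> [FH uH] uM uh; have [v [_ vU]] := uH H h FH.
  by move=> x; rewrite -(vU u)// (vU id).
exists f; split=> //; split=> //; exists g => x.
  apply: (endo F i (g \o f)) => //; first exact: fmorphism_comp.
  by move=> y /=; rewrite fi gk.
apply: (endo G k (f \o g)) => //; first exact: fmorphism_comp.
by move=> y /=; rewrite gk fi.
Qed.

Theorem proposition4p10 (X : Type) (hX : inhabited X) :
  @is_FFR X (FFR_model X) (@model_gen X) /\
  forall (F : falgebra) (i : X -> F), @is_FFR X F i ->
    exists f : FFR_model X -> F,
      @fmorphism (FFR_model X) F f /\ bijective f /\
      @canonical_for X (FFR_model X) F (@model_gen X) i f.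
Proof.
by split=> [|F i FF]; [exact: model_FFR | exact: (FFR_iso (model_FFR X) FF)].
Qed.
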